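(* Let $n\geq 2$ be an integer. Then the discriminant of $\Psi_n(x,y)$, regarded as a polynomial in $x$ with coefficients in $\mathbb{Z}[y]$, is $$\begin{cases} \dfrac{(-1)^{\lfloor\varphi(n)/2\rfloor}(2n)^{\varphi(n)}\,y^{\varphi(n)(\varphi(n)-1)}}{p^{p^{\alpha-1}+1}}&\text{if } n=p^\alpha \text{ for some prime } p \text{ and some positive integer } \alpha;\\[2ex] \dfrac{(-1)^{\varphi(n)/2}(2n)^{\varphi(n)}\,y^{\varphi(n)(\varphi(n)-1)}}{\prod_{p\mid n}p^{\varphi(n)/(p-1)}}&\text{otherwise}, \end{cases}$$ where the product runs over the primes $p$ dividing $n$.
   Context: The Fibonacci polynomials are defined by $F_1(x)=1$, $F_2(x)=x$, and $F_n(x)=xF_{n-1}(x)+F_{n-2}(x)$ for $n\geq 3$. For $n\geq 2$, the $n$-th fibotomic polynomial $\Psi_n(x)\in\mathbb{Z}[x]$ is the product of the monic irreducible factors of $F_n(x)$ which are not factors of $F_k(x)$ for any $k<n$; also $\Psi_1(x)=1$. Thus $F_n(x)=\prod_{d\mid n}\Psi_d(x)$ for all $n\geq1$, and for $n\geq 2$, $\Psi_n(x)$ is monic of degree $\varphi(n)$, where $\varphi$ is Euler's totient function. The homogenized fibotomic polynomials are $\Psi_1(x,y)=1$ and $\Psi_n(x,y)=y^{\varphi(n)}\Psi_n(x/y)$ for $n\geq2$; these are homogeneous of degree $\varphi(n)$ and monic in $x$. The discriminant of a monic polynomial with roots $r_1,\dots,r_d$ is $\prod_{i<j}(r_i-r_j)^2$.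 *)

(* Defs.v *)
From HB Require Import structures.
From mathcomp Require Import all_boot all_order all_algebra.
Set Implicit Arguments. Unset Strict Implicit. Unset Printing Implicit Defensive.
Import Order.TTheory GRing.Theory Num.Theory.
Local Open Scope ring_scope.

Fixpoint fibpoly (n : nat) : {poly int} :=
  match n with
  | 0 => 0
  | 1 => 1
  | (m.+1 as k).+1 => 'X * fibpoly k + fibpoly m
  end.

(* Homogenization of p in degree d, as a polynomial in x with coefficients
   in R[y]:  sum_{i<=d} p_i y^(d-i) x^i  (= y^d p(x/y) when deg p <= d). *)
Definition homog (R : nzRingType) (p : {poly R}) (d : nat) : {poly {poly R}} :=
  \poly_(i < d.+1) ((p`_i)%:P * 'X^(d - i)).

Definition is_discriminant (R : comNzRingType) (P : {poly R}) (D : R) : Prop :=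
  forall (L : fieldType) (f : {rmorphism R -> L}) (rs : seq L),
    map_poly f P = \prod_(r <- rs) ('X - r%:P) ->
    f D = \prod_(i < size rs) \prod_(j < size rs | (i < j)%N)
            (rs`_i - rs`_j) ^+ 2.

(* Main.v *)
(** Let [w] be a primitive [2n]-th root of unity and [z = w ^ 2].  Substituting
  [x = u - 1/u] in [F_n] shows that the roots of [Psi_n] are the numbers
  [r_k = i (w^k + w^-k)] with [k < n] prime to [n].  They satisfy
  [|r_k - r_j| = |1 - w^(k+j)| |w^k - w^j|], and replacing [j] by [n - j] in
  the first factor gives
  [prod_(j != k) |r_k - r_j| = 2 / |1 - z^k| prod_(j != k) |z^k - z^j|],
  which reduces the absolute value of the discriminant to that of the
  [n]-th cyclotomic polynomial and its value at [1].  The former is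
  [n ^ phi(n) / prod |z^k - z^j|] over [k] prime and [j] not prime to [n];
  there the difference [v = j - k] contributes only when [z^v] has order
  [p ^ a] with [p ^ a] the full power of [p] dividing [n].  The sign is clear
  since the [r_k] are purely imaginary.

  The discriminant is an integral polynomial in the coefficients, so it is
  enough to compute it with the roots [r_k y] in [algC[y]]. *)

Require Import Defs.
From HB Require Import structures.
From mathcomp Require Import all_boot all_order all_algebra all_fingroup all_field ring zify.
From mathcomp Require mpoly.
Import Order.TTheory GRing.Theory Num.Theory.
Local Open Scope ring_scope.

(** * The discriminant as an integral polynomial in the coefficients *)

(* The import is confined to a section because [mpoly] turns [homog] into a
  keyword. *)
Section GenericDiscriminant.
Import mpoly.

(* Squared Vandermonde determinants make the symmetry of the discriminant
  visible: permuting the variables multiplies the determinant by a sign. *)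
Lemma prod_ltn_sqr (R : comNzRingType) m (v : 'I_m -> R) :
  \prod_(i < m) \prod_(j < m | (i < j)%N) (v i - v j) ^+ 2 =
  \det (Vandermonde m (\row_i v i)) ^+ 2.
Proof.
rewrite det_Vandermonde -prodrXl; apply: eq_bigr => i _.
rewrite -prodrXl; apply: eq_bigr => j _.
by rewrite !mxE -sqrrN opprB.
Qed.

Definition disc {R : comNzRingType} (s : seq R) : R :=
  \prod_(i < size s) \prod_(j < size s | (i < j)%N) (s`_i - s`_j) ^+ 2.

Definition generic_disc m : {mpoly int[m]} :=
  \prod_(i < m) \prod_(j < m | (i < j)%N) ('X_i - 'X_j) ^+ 2.

Lemma generic_disc_sym m : generic_disc m \is symmetric.
Proof.
apply/issymP => s; rewrite /generic_disc prod_ltn_sqr rmorphXn /= -det_map_mx.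
set V := Vandermonde _ _.
have -> : map_mx (msym s) V = V *m (perm_mx s)^T.
  rewrite tr_perm_mx -col_permE; apply/matrixP => i j.
  rewrite !mxE rmorphXn /=; congr (_ ^+ _).
  rewrite msymX; congr 'X_[_]; apply/mnmP => k; rewrite mnmE !mnm1E.
  by rewrite (canF_eq (permK s)).
rewrite det_mulmx det_tr det_perm exprMn sqrr_sign mulr1 //.
Qed.

Lemma mmap_comp_mpoly m k (R : comNzRingType) (t : {mpoly int[m]})
    (lq : m.-tuple {mpoly int[k]}) (v : 'I_k -> R) :
  mmap intr v (t \mPo lq) = mmap intr (fun i => mmap intr v (tnth lq i)) t.
Proof.
rewrite /comp_mpoly [X in mmap _ _ X]/mmap rmorph_sum /= [RHS]/mmap.
apply: eq_bigr => mm _; rewrite rmorphM /= mmapC; congr (_ * _).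
by rewrite /mmap1 rmorph_prod /=; apply: eq_bigr => i _; rewrite rmorphXn.
Qed.

Lemma mmap_mesym m k (R : comNzRingType) (v : 'I_m -> R) :
  mmap intr v (mesym m int k) = (mesym m R k).@[v].
Proof.
rewrite /mesym !rmorph_sum /=; apply: eq_bigr => A _.
by rewrite !rmorph_prod /=; apply: eq_bigr => i _; rewrite mevalXU mmapX mmap1U.
Qed.

Lemma mmap_generic_disc (R : comNzRingType) (s : seq R) :
  mmap intr (fun i : 'I_(size s) => s`_i) (generic_disc (size s)) = disc s.
Proof.
rewrite rmorph_prod; apply: eq_bigr => i _.
rewrite rmorph_prod; apply: eq_bigr => j _.
by rewrite rmorphXn rmorphB /= !mmapX !mmap1U.
Qed.

Lemma eq_mmap m (R : nzRingType) (v w : 'I_m -> R) (t : {mpoly int[m]}) :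
  v =1 w -> mmap intr v t = mmap intr w t.
Proof.
by move=> vw; apply: eq_bigr => mm _; congr (_ * _); apply: mmap1_eq.
Qed.

(** The fundamental theorem of symmetric polynomials, combined with Vieta's formulas. Since [t]
    depends on [m] alone, one integral polynomial serves all domains [R]. *)
Lemma disc_coefs m : {t : {mpoly int[m]} |
  forall (R : idomainType) (s : seq R), size s = m ->
  disc s = mmap intr (fun i : 'I_m =>
     (-1) ^+ i.+1 * (\prod_(r <- s) ('X - r%:P))`_(m - i.+1)) t}.
Proof.
have [t [tE _]] := sym_fundamental (generic_disc_sym m).
exists t => R s sm; case: m / sm t tE => t tE.
rewrite -mmap_generic_disc -tE mmap_comp_mpoly.
apply: eq_mmap => i.
rewrite tnth_mktuple mmap_mesym.
have ilt : (i.+1 < (size s).+1)%N by rewrite ltnS.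
rewrite (mroots_coeff (in_tuple s) (Ordinal ilt)) /= mulrA -expr2 sqrr_sign mul1r.
by apply: meval_eq => j; rewrite (tnth_nth 0).
Qed.

Lemma mmap_intr_morph m (R S : comNzRingType) (g : {rmorphism R -> S})
    (v : 'I_m -> R) (t : {mpoly int[m]}) :
  g (mmap intr v t) = mmap intr (g \o v) t.
Proof.
rewrite /mmap rmorph_sum; apply: eq_bigr => mm _.
rewrite rmorphM /= rmorph_int; congr (_ * _).
by rewrite rmorph_prod; apply: eq_bigr => i _; rewrite rmorphXn.
Qed.

(* One factorization over an injective extension suffices: both [D] and the
  discriminant over any other field are values of the same integral polynomial
  in the coefficients of [P]. *)
Lemma is_discriminant_inj (R : comNzRingType) (S : idomainType)
    (g : {rmorphism R -> S}) (P : {poly R}) (D : R) (s : seq S) :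
  injective g -> map_poly g P = \prod_(r <- s) ('X - r%:P) -> g D = disc s ->
  is_discriminant P D.
Proof.
move=> inj_g gP gD L f rs fP; rewrite -/(disc rs).
have szP : size P = (size s).+1.
  by rewrite -(size_map_inj_poly inj_g (rmorph0 g)) gP size_prod_XsubC.
have monP : P \is monic.
  rewrite monicE; apply/eqP/inj_g; rewrite rmorph1 -lead_coef_map_inj ?rmorph0 //.
  by rewrite gP; apply/monicP; rewrite monic_prod_XsubC.
(* [f] may fail to be injective; the degree survives because [P] is monic. *)
have szrs : size rs = size s.
  apply/eq_add_S; rewrite -(size_prod_XsubC rs id) -fP -szP size_map_poly_id0 //.
  by rewrite (monicP monP) rmorph1 oner_neq0.
have [t tE] := disc_coefs (size s).
have -> : D = mmap intr (fun i : 'I_(size s) => (-1) ^+ i.+1 * P`_(size s - i.+1)) t.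
  apply: inj_g; rewrite gD tE // mmap_intr_morph.
  apply: eq_mmap => i /=.
  by rewrite rmorphM rmorph_sign /= -gP coef_map.
rewrite tE // mmap_intr_morph; apply: eq_mmap => i /=.
by rewrite rmorphM rmorph_sign /= -fP coef_map.
Qed.

End GenericDiscriminant.

(** * Scaling of the discriminant and homogenization *)

Lemma prod_ltn_const (R : comNzRingType) m (c : R) :
  \prod_(i < m) \prod_(j < m | (i < j)%N) c = c ^+ 'C(m, 2).
Proof.
elim: m => [|m IHm]; first by rewrite big_ord0.
rewrite big_ord_recl (eq_bigr (fun i : 'I_m => \prod_(j < m | (i < j)%N) c)).
  rewrite IHm binS bin1 addnC exprD; congr (_ * _).
  by rewrite big_mkcond big_ord_recl /= mul1r prodr_const card_ord.
move=> i _; rewrite big_mkcond big_ord_recl /= mul1r.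
by rewrite [RHS]big_mkcond; apply: eq_bigr.
Qed.

Lemma disc_scale (R : comNzRingType) (s : seq R) :
  disc [seq r%:P * 'X | r <- s] = (disc s)%:P * 'X^(size s * (size s).-1).
Proof.
rewrite /disc size_map; set m := size s.
rewrite (eq_bigr (fun i : 'I_m => \prod_(j < m | (i < j)%N) ((s`_i - s`_j) ^+ 2)%:P *
    \prod_(j < m | (i < j)%N) ('X ^+ 2))) => [|i _]; last first.
  rewrite -big_split; apply: eq_bigr => j _ /=.
  by rewrite !(nth_map 0) // -mulrBl -rmorphB exprMn rmorphXn.
rewrite big_split prod_ltn_const -exprM -[m.-1]bin1 mul_bin_diag /=; congr (_ * _).
  by rewrite rmorph_prod; apply: eq_bigr => i _; rewrite rmorph_prod.
Qed.

Lemma coef_homog (R : nzRingType) (p : {poly R}) d i :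
  (homog p d)`_i = if (i <= d)%N then (p`_i)%:P * 'X^(d - i) else 0.
Proof. exact: coef_poly. Qed.

Lemma homog_map (R S : nzRingType) (h : {rmorphism R -> S}) (p : {poly R}) d :
  map_poly (map_poly h) (homog p d) = homog (map_poly h p) d.
Proof.
apply/polyP => i; rewrite coef_map_id0 ?rmorph0 // !coef_homog coef_map /=.
by case: ifP => _; rewrite ?rmorph0 // rmorphM /= map_polyC map_polyXn.
Qed.

Lemma homog_prod_XsubC (R : comNzRingType) (s : seq R) :
  homog (\prod_(r <- s) ('X - r%:P)) (size s) =
  \prod_(r <- s) ('X - (r%:P * 'X)%:P).
Proof.
elim: s => [|r s IHs].
  rewrite !big_nil; apply/polyP => i; rewrite coef_homog /= !coef1.
  by case: i => [|i] //=; rewrite mulr1.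
rewrite !big_cons -IHs; set q := \prod_(_ <- s) _.
have szq : size q = (size s).+1 by rewrite size_prod_XsubC.
apply/polyP => i; rewrite !mulrBl coefB coef_homog !coefB !coefXM !coefCM !coef_homog.
case: i => [|i] /=; first by rewrite !subn0 !sub0r exprS rmorphN rmorphM /=; ring.
rewrite !ltnS subSS rmorphB rmorphM /=.
case: (ltngtP i (size s)) => [lt_is|gt_is|->].
- by rewrite -(subnSK lt_is) exprS; ring.
- by rewrite mulr0 subrr.
- by rewrite [q`_(size s).+1]nth_default ?szq // polyC0 !mulr0 !subr0.
Qed.

(** * Products over divisors *)

(** Indices are grouped by $d = n / \gcd(k, n)$; the index [0] falls under [d = 1]. *)
Lemma big_ord_divisors (R : Type) (idx : R) (op : Monoid.com_law idx) n
    (F : nat -> R) : (0 < n)%N ->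
  \big[op/idx]_(k < n) F k =
  \big[op/idx]_(d <- divisors n) \big[op/idx]_(k < d | coprime k d) F (n %/ d * k)%N.
Proof.
move=> n_gt0.
transitivity (\big[op/idx]_(k < n) \big[op/idx]_(d <- divisors n)
    if (gcdn k n * d == n)%N then F k else idx).
  apply: eq_bigr => k _; have g_gt0 : (0 < gcdn k n)%N by rewrite gcdn_gt0 n_gt0 orbT.
  rewrite (bigD1_seq (n %/ gcdn k n)%N) ?divisors_uniq //=; last first.
    by rewrite -dvdn_divisors // dvdn_div ?dvdn_gcdr.
  rewrite [X in X == _]mulnC divnK ?dvdn_gcdr // eqxx big1 ?Monoid.mulm1 // => d.
  by case: (_ =P n) => // gd_n; rewrite (_ : (n %/ _)%N = d) ?eqxx // -{1}gd_n mulKn.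
rewrite exchange_big big_seq [RHS]big_seq; apply: eq_bigr => d.
rewrite -dvdn_divisors // => /dvdnP[g nE]; rewrite -big_mkcond /=.
have [g_gt0 d_gt0] : (0 < g)%N /\ (0 < d)%N by apply/andP; rewrite -muln_gt0 -nE.
have nd : (n %/ d)%N = g by rewrite nE mulnK.
have gcd_gk k : (gcdn (g * k) n * d == n)%N = coprime k d.
  by rewrite nE -muln_gcdr -mulnA eqn_pmul2l // -[X in _ == X]mul1n eqn_pmul2r.
have ltgk (k : 'I_d) : (g * k < n)%N by rewrite nE ltn_pmul2l.
have ltkg (k : 'I_n) : (k %/ g < d)%N by rewrite ltn_divLR // mulnC -nE.
rewrite (reindex_onto (fun k => Ordinal (ltgk k)) (fun k => Ordinal (ltkg k))) /=.
  apply: eq_big => [k|k _]; last by rewrite nd.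
  by rewrite gcd_gk -val_eqE /= mulKn // eqxx andbT.
move=> k gE; have {}gE : gcdn k n = g by apply/eqP; rewrite -(eqn_pmul2r d_gt0) -nE.
by apply: val_inj; rewrite /= mulnC divnK // -gE dvdn_gcdl.
Qed.

(** Multiplicative Möbius inversion by strong induction: the nonzero factors at the proper divisors
    of [m] cancel. *)
Lemma eq_from_divisors_prod (R : idomainType) n (f g : nat -> R) :
  (0 < n)%N -> (forall m, (m %| n)%N -> g m != 0) ->
  (forall m, (m %| n)%N ->
     \prod_(d <- divisors m) f d = \prod_(d <- divisors m) g d) ->
  forall m, (m %| n)%N -> f m = g m.
Proof.
move=> n_gt0 g_neq0 fg m; have [k] := ubnP m; elim: k m => // k IHk m.
rewrite ltnS => le_mk m_n; have m_gt0 : (0 < m)%N by apply: dvdn_gt0 m_n.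
have dvd_mm : m \in divisors m by rewrite -dvdn_divisors.
have := fg m m_n; rewrite !(bigD1_seq m) ?divisors_uniq //=.
rewrite [X in _ * X = _](_ : _ = \prod_(d <- divisors m | d != m) g d).
  apply: mulIf; rewrite prodf_seq_neq0; apply/allP => d.
  rewrite -dvdn_divisors // => d_m; apply/implyP => _.
  by apply: g_neq0; apply: dvdn_trans m_n.
rewrite big_seq_cond [RHS]big_seq_cond; apply: eq_bigr => d /andP[].
rewrite -dvdn_divisors // => d_m d_neq_m; apply: IHk; last exact: dvdn_trans m_n.
by apply: leq_trans le_mk; rewrite ltn_neqAle d_neq_m dvdn_leq.
Qed.

Lemma primes_prime_power p i : prime p -> primes (p ^ i.+1) = [:: p].
Proof. by move=> p_pr; rewrite primesX ?primes_prime. Qed.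

Lemma prime_powerP d p :
  primes d = [:: p] -> prime p /\ exists i, d = (p ^ i.+1)%N.
Proof.
move=> pd; have: p \in primes d by rewrite pd inE.
rewrite mem_primes => /and3P[p_pr d_gt0 p_d]; split=> //.
have: p.-nat d.
  rewrite /pnat d_gt0; apply/allP => q; by rewrite pd inE => /eqP->; rewrite inE.
case/p_natP => // -[|i] dE; last by exists i.
by rewrite dE in pd.
Qed.

Lemma big_divisors_prime_powers (R : Type) (idx : R) (op : Monoid.com_law idx) n
    (F : nat -> R) : (0 < n)%N ->
  (forall d, (d %| n)%N -> size (primes d) != 1%N -> F d = idx) ->
  \big[op/idx]_(d <- divisors n) F d =
  \big[op/idx]_(p <- primes n) \big[op/idx]_(i < logn p n) F (p ^ i.+1)%N.
Proof.
move=> n_gt0 F1.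
rewrite (bigID (fun d => size (primes d) == 1%N)) /= [X in op _ X]big1_seq; last first.
  by move=> d /andP[d1]; rewrite -dvdn_divisors // => d_n; apply: F1.
rewrite Monoid.mulm1 -big_filter.
transitivity (\big[op/idx]_(d <- [seq (p ^ i.+1)%N | p <- primes n,
    i <- iota 0 (logn p n)]) F d); last first.
  rewrite big_allpairs_dep; apply: eq_bigr => p _.
  by rewrite -[logn p n in LHS]subn0 big_mkord.
apply: perm_big; apply: uniq_perm.
- by rewrite filter_uniq ?divisors_uniq.
- apply: allpairs_uniq_dep => [|p _|]; rewrite ?primes_uniq ?iota_uniq //.
  move=> [p i] [q j] /allpairsPdep[p' [i' [p'n _ /= [-> ->]]]].
  move=> /allpairsPdep[q' [j' [q'n _ /= [-> ->]]]] pq.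
  move: p'n q'n; rewrite !mem_primes => /andP[p_pr _] /andP[q_pr _].
  have [eq_pq] : [:: p'] = [:: q'] by rewrite -(primes_prime_power p' i' p_pr) pq primes_prime_power.
  move: pq p_pr; rewrite eq_pq => pq p_pr; congr existT.
  by have := congr1 (logn q') pq; rewrite !pfactorK // => -[].
move=> d; rewrite mem_filter -dvdn_divisors //; apply/andP/allpairsPdep.
  case=> d1 d_n; have : exists p, primes d = [:: p].
    by case: (primes d) d1 => [|p []] // _; exists p.
  case=> p /[dup] pd /prime_powerP[p_pr [i dE]]; exists p, i; split=> //.
    by rewrite mem_primes p_pr n_gt0 (dvdn_trans _ d_n) // dE dvdn_exp.
  by rewrite mem_iota add0n -pfactor_dvdn // -dE.
case=> p [i [p_n i_n ->]]; move: p_n; rewrite mem_primes => /and3P[p_pr _ _].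
by rewrite primes_prime_power // pfactor_dvdn //; move: i_n; rewrite mem_iota.
Qed.

(* The exponential of the von Mangoldt function. *)
Definition mangoldt_exp n : nat := if primes n is [:: p] then p else 1%N.

(** Multiplicative form of $\sum_{d \mid n} \Lambda(d) = \log n$. *)
Lemma prod_mangoldt_exp n : (0 < n)%N ->
  (\prod_(d <- divisors n) mangoldt_exp d)%N = n.
Proof.
move=> n_gt0; rewrite big_divisors_prime_powers //; last first.
  by move=> d _; rewrite /mangoldt_exp; case: (primes d) => [|p []].
rewrite [RHS](prod_prime_decomp n_gt0) prime_decompE big_map /=.
rewrite big_seq [RHS]big_seq; apply: eq_bigr => p; rewrite mem_primes => /and3P[p_pr _ _].
under eq_bigr => i _ do rewrite /mangoldt_exp primes_prime_power //.
by rewrite big_const_ord iter_muln_1.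
Qed.

(** * Roots of the Fibonacci and fibotomic polynomials *)

Lemma fibpolyS n : fibpoly n.+2 = 'X * fibpoly n.+1 + fibpoly n.
Proof. by []. Qed.

Lemma size_monic_fibpoly n : size (fibpoly n) = n /\ ((0 < n)%N -> fibpoly n \is monic).
Proof.
have [k] := ubnP n; elim: k n => // k IHk [|[|n]] ltnk.
- by rewrite size_poly0.
- by rewrite size_poly1 monic1.
have [szn _] := IHk n (ltn_trans (ltnSn _) ltnk).
have [szn1 /(_ isT) mon_n1] := IHk n.+1 ltnk.
have szX : size ('X * fibpoly n.+1) = n.+2.
  by rewrite mulrC size_mulX ?monic_neq0 ?szn1.
have lt_sz : (size (fibpoly n) < size ('X * fibpoly n.+1)%R)%N by rewrite szX szn.
rewrite fibpolyS size_polyDl // szX monicE lead_coefDl // lead_coefM lead_coefX.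
by rewrite mul1r -monicE.
Qed.

(** [z] and [- z^-1] are the roots of $T^2 = xT + 1$ for $x = z - 1/z$, so both sides obey the same
    recurrence. The factor [z + z^-1] is kept on the left because it may vanish. *)
Lemma fibpoly_binet (F : fieldType) (z : F) n : z != 0 ->
  (map_poly intr (fibpoly n)).[z - z^-1] * (z + z^-1) = z ^+ n - (- z^-1) ^+ n.
Proof.
move=> z_neq0; have [k] := ubnP n; elim: k n => // k IHk [|[|n]] ltnk.
- by rewrite rmorph0 horner0 mul0r !expr0 subrr.
- by rewrite rmorph1 hornerC mul1r !expr1 opprK.
have IH0 := IHk n (ltn_trans (ltnSn _) ltnk); have IH1 := IHk n.+1 ltnk.
rewrite fibpolyS rmorphD rmorphM /= map_polyX hornerD hornerM hornerX mulrDl -mulrA.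
rewrite IH0 IH1 !exprS; field.
exact: z_neq0.
Qed.

Lemma prim_root_neq0 (R : nzRingType) n (z : R) : n.-primitive_root z -> z != 0.
Proof.
move=> z_prim; apply/eqP => z0; have /eqP := prim_expr_order z_prim.
by rewrite z0 expr0n -(prednK (prim_order_gt0 z_prim)) eq_sym oner_eq0.
Qed.

(** This is $z - 1/z$ at $z = i w^k$; for $w = e^{\pi i/n}$ it equals $2i\cos(\pi k/n)$. *)
Definition fibroot (w : algC) (k : nat) : algC := 'i * (w ^+ k + w ^- k).

Lemma fibroot_exp w a k : fibroot (w ^+ a) k = fibroot w (a * k).
Proof. by rewrite /fibroot -exprM. Qed.

Lemma fibrootB (w : algC) j k : w != 0 ->
  fibroot w j - fibroot w k = 'i * w ^- j * w ^- k * (w ^+ (j + k) - 1) * (w ^+ j - w ^+ k).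
Proof.
move=> w_neq0; rewrite /fibroot exprD.
have wj : w ^+ j != 0 by rewrite expf_neq0.
have wk : w ^+ k != 0 by rewrite expf_neq0.
by field; rewrite wj wk.
Qed.

(** The [n.-1] candidates are roots by Binet's formula and are distinct, and [n.-1] is the
    degree. *)
Lemma fibpoly_roots n w : (2 * n).-primitive_root w ->
  map_poly intr (fibpoly n) = \prod_(k <- iota 1 n.-1) ('X - (fibroot w k)%:P).
Proof.
move=> w_prim; have [sz mon] := size_monic_fibpoly n.
have n_gt0 : (0 < n)%N by move: (prim_order_gt0 w_prim); rewrite muln_gt0.
have w_neq0 : w != 0 by apply: prim_root_neq0 w_prim.
have inj : injective (intr : int -> algC) by exact: intr_inj.
rewrite -(big_map (fibroot w) xpredT (fun x => 'X - x%:P)).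
rewrite [LHS](all_roots_prod_XsubC (rs := [seq fibroot w k | k <- iota 1 n.-1])).
- by rewrite lead_coef_map_inj // (monicP (mon n_gt0)) scale1r.
- by rewrite size_map_inj_poly // sz size_map size_iota prednK.
- apply/allP => _ /mapP[k + ->]; rewrite mem_iota => /andP[k_gt0 k_lt].
  have {}k_lt : (k < n)%N by lia.
  set z := 'i * w ^+ k.
  have z_neq0 : z != 0 by rewrite mulf_neq0 ?neq0Ci ?expf_neq0.
  have zV : z^-1 = - 'i * w ^- k by rewrite invfM invCi.
  have := fibpoly_binet _ z n z_neq0.
  rewrite zV [X in _.[X]](_ : _ = fibroot w k); last by rewrite /fibroot /z; ring.
  (* $w^{kn}$ is its own inverse, so the right side of Binet's formula vanishes. *)
  have w2kn : w ^+ (k * n) * w ^+ (k * n) = 1.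
    by apply/eqP; rewrite -exprD -(prim_order_dvd w_prim); apply/dvdnP; exists k; lia.
  have -> : z ^+ n - (- (- 'i * w ^- k)) ^+ n = 0.
    rewrite mulNr opprK !exprMn -mulrBr exprVn -!exprM.
    suff -> : (w ^+ (k * n))^-1 = w ^+ (k * n) by rewrite subrr mulr0.
    by apply: (mulfI (expf_neq0 (k * n) w_neq0)); rewrite mulfV ?expf_neq0.
  move/eqP; rewrite mulf_eq0 => /orP[//|].
  (* The cofactor is $i(w^k - w^{-k})$; its vanishing would give $w^{2k} = 1$ with $0 < 2k < 2n$. *)
  rewrite mulNr -mulrBr mulf_eq0 (negPf (neq0Ci _)) subr_eq0 => /eqP wk.
  have : w ^+ (k + k) == 1 by rewrite exprD {2}wk mulfV ?expf_neq0.
  by rewrite -(prim_order_dvd w_prim) => /dvdn_leq; lia.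
rewrite uniq_rootsE map_inj_in_uniq ?iota_uniq // => j k.
rewrite !mem_iota => /andP[j_gt0 j_lt] /andP[k_gt0 k_lt] /eqP.
(* Equal candidates force $w^{j+k} = 1$, excluded by the bounds, or $w^j = w^k$, which gives $j =
   k$. *)
rewrite -subr_eq0 fibrootB // !mulf_eq0 !invr_eq0 !expf_eq0 (negPf w_neq0) !andbF.
rewrite (negPf (neq0Ci _)) /= !subr_eq0 -(prim_order_dvd w_prim).
rewrite (eq_prim_root_expr w_prim) => /orP[/dvdn_leq|]; first by lia.
by rewrite !modn_small; [move/eqP | lia | lia].
Qed.

(* The index [k = 0] carries no root, hence the factor [1]: the product over
  [k < n] then splits along the divisors of [n], [d = 1] included. *)
Definition fibfactor (w : algC) k : {poly algC} :=
  if k == 0%N then 1 else 'X - (fibroot w k)%:P.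

Lemma fibpoly_factor n w : (2 * n).-primitive_root w ->
  map_poly intr (fibpoly n) = \prod_(k < n) fibfactor w k.
Proof.
move=> w_prim; rewrite (fibpoly_roots n w w_prim).
have n_gt0 : (0 < n)%N by move: (prim_order_gt0 w_prim); rewrite muln_gt0.
case: n n_gt0 {w_prim} => // n _ /=; rewrite big_ord_recl mul1r.
rewrite -[X in iota _ X]/n (iotaDl 1 0) big_map -[n in LHS]subn0 big_mkord.
exact: eq_bigr.
Qed.

Lemma fibotomic_roots (Psi : nat -> {poly int}) n w :
  (forall m, (0 < m)%N -> fibpoly m = \prod_(d <- divisors m) Psi d) ->
  (2 * n).-primitive_root w ->
  map_poly intr (Psi n) = \prod_(k < n | coprime k n) fibfactor w k.
Proof.
move=> PsiE w_prim.
have n_gt0 : (0 < n)%N by move: (prim_order_gt0 w_prim); rewrite muln_gt0.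
pose f m : {poly algC} := map_poly intr (Psi m).
(* All levels share one [w]: [w ^+ (n %/ m)] is a primitive [2 * m]-th root of unity. Both [f] and
   [g] multiply to $F_m$ over the divisors of [m]. *)
pose g m : {poly algC} := \prod_(k < m | coprime k m) fibfactor w (n %/ m * k)%N.
have := eq_from_divisors_prod _ n f g n_gt0 _ _ n (dvdnn n); rewrite /f /g => ->.
- by rewrite divnn n_gt0; apply: eq_bigr => k _; rewrite mul1n.
- move=> m _; apply/prodf_neq0 => k _; rewrite /fibfactor.
  by case: ifP => _; rewrite ?oner_neq0 ?polyXsubC_eq0.
move=> m m_n; have m_gt0 : (0 < m)%N by apply: dvdn_gt0 m_n.
have nm_gt0 : (0 < n %/ m)%N by rewrite divn_gt0 // dvdn_leq.
have wm_prim : (2 * m).-primitive_root (w ^+ (n %/ m)).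
  by rewrite -[(n %/ m)%N](@divnMl 2) // dvdn_prim_root // dvdn_pmul2l.
rewrite -rmorph_prod -PsiE //= (fibpoly_factor m _ wm_prim).
rewrite (eq_bigr (fun k : 'I_m => fibfactor w (n %/ m * k)%N)); last first.
  by move=> k _; rewrite /fibfactor fibroot_exp muln_eq0 -[(_ %/ _ == 0)%N]negbK -lt0n nm_gt0.
rewrite (big_ord_divisors _ _ _ _ (fun k => fibfactor w (n %/ m * k)%N)) //.
rewrite big_seq [RHS]big_seq; apply: eq_bigr => d; rewrite -dvdn_divisors // => d_m.
apply: eq_bigr => k _; rewrite mulnA; congr fibfactor; congr muln.
by rewrite muln_divA // divnK.
Qed.

(** * Units modulo n and their shifts *)

Lemma coprime_primeP k n : (0 < n)%N ->
  reflect (forall q, prime q -> (q %| n)%N -> ~~ (q %| k)%N) (coprime k n).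
Proof.
move=> n_gt0; apply: (iffP idP) => [co_kn q q_pr q_n | no_q].
  rewrite -prime_coprime //; apply: coprime_dvdl q_n _.
  by rewrite coprime_sym.
rewrite /coprime eqn_leq gcdn_gt0 n_gt0 orbT andbT leqNgt; apply/negP => g_gt1.
have := no_q _ (pdiv_prime g_gt1) (dvdn_trans (pdiv_dvd _) (dvdn_gcdr _ _)).
by rewrite (dvdn_trans (pdiv_dvd _) (dvdn_gcdl _ _)).
Qed.

(* Units modulo [e] lift to units modulo [n]: solve [u = j] modulo the part of
  [n] supported on the primes of [e], and [u = 1] modulo the rest. *)
Lemma coprime_lift n e j : (0 < n)%N -> (e %| n)%N -> coprime j e ->
  exists2 u, coprime u n & u = j %[mod e].
Proof.
move=> n_gt0 e_n co_je; have e_gt0 := dvdn_gt0 n_gt0 e_n.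
pose n1 := (n`_\pi(e))%N; pose n2 := (n`_(\pi(e)^'))%N.
have nE : n = (n1 * n2)%N by rewrite partnC.
have co12 : coprime n1 n2 by exact: coprime_partC.
have co_jn1 : coprime j n1.
  apply/coprime_primeP => [|q q_pr q_n1]; first exact: part_gt0.
  have := pnat_dvd q_n1 (part_pnat _ _); rewrite pnatE // mem_primes => /and3P[_ _ q_e].
  exact: (coprime_primeP _ _ e_gt0 co_je).
exists (chinese n1 n2 j 1); last first.
  have e_n1 : (e %| n1)%N by rewrite -(part_pnat_id (pnat_pi e_gt0)) partn_dvd.
  by rewrite -(modn_dvdm _ e_n1) chinese_modl // modn_dvdm.
rewrite nE coprimeMr -coprime_modl chinese_modl // coprime_modl co_jn1.
by rewrite -coprime_modl chinese_modr // coprime_modl coprime1n.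
Qed.

Lemma card_mul_unit n u (P : pred nat) : coprime u n ->
  (forall k, P (k %% n)%N = P k) ->
  #|[pred k : 'I_n | P (u * k)%N]| = #|[pred k : 'I_n | P k]|.
Proof.
case: n => [|n] co_un Pmod; first by rewrite !eq_card0 // => -[].
pose h (k : 'I_n.+1) : 'I_n.+1 := inord (u * k %% n.+1).
have hE k : h k = (u * k %% n.+1)%N :> nat by rewrite inordK ?ltn_pmod.
have h_inj : injective h.
  move=> j k /(congr1 val) /=; rewrite !hE => /eqP.
  wlog le_kj : j k / (k <= j)%N => [wlg|].
    by case/orP: (leq_total k j) => [/wlg //|/wlg wlg_kj]; rewrite eq_sym => /wlg_kj.
  rewrite eqn_mod_dvd ?leq_mul2l ?le_kj ?orbT // -mulnBr Gauss_dvdr 1?coprime_sym //.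
  rewrite -eqn_mod_dvd // !modn_small ?ltn_ord // => /eqP.
  exact: val_inj.
rewrite -!sum1_card [RHS](reindex_inj h_inj) /=.
by apply: eq_bigl => k; rewrite !inE /= hE Pmod.
Qed.

(** The number of pairs of a unit [k] and a nonunit [j] modulo [n] with difference [v]: the exponent
    of $|1 - z^v|$ in the product of distances between such powers of [z]. *)
Definition coprime_shift_defect n v :=
  #|[pred k : 'I_n | coprime k n && ~~ coprime (k + v) n]|.

Lemma coprime_shift_defect_mul n u v : coprime u n ->
  coprime_shift_defect n (u * v) = coprime_shift_defect n v.
Proof.
move=> co_un.
pose P := [pred k | coprime k n && ~~ coprime (k + u * v) n].
rewrite /coprime_shift_defect -(card_mul_unit n u P) //=.
  apply: eq_card => k; rewrite !inE -mulnDr !coprimeMl.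
  by rewrite co_un.
move=> k; rewrite coprime_modl; congr (_ && ~~ _).
by rewrite -coprime_modl modnDml coprime_modl.
Qed.

(** The defect depends only on the additive order [e] of the shift: a lift of [j] to a unit modulo
    [n] carries [n %/ e] to [n %/ e * j]. *)
Lemma coprime_shift_defect_divisor n e j : (0 < n)%N -> (e %| n)%N -> coprime j e ->
  coprime_shift_defect n (n %/ e * j) = coprime_shift_defect n (n %/ e).
Proof.
move=> n_gt0 e_n co_je; have [u co_un uj] := coprime_lift _ _ _ n_gt0 e_n co_je.
rewrite -[RHS](coprime_shift_defect_mul _ u) // [(u * _)%N]mulnC.
apply: eq_card => k; rewrite !inE; congr (_ && ~~ _).
rewrite -coprime_modl -[RHS]coprime_modl -modnDmr -[in RHS]modnDmr.
congr coprime; congr ((_ + _) %% _)%N.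
by rewrite -{2 4}(divnK e_n) -!muln_modr uj.
Qed.

Lemma coprime_shift_defect0 n v : (0 < n)%N ->
  (forall q, prime q -> (q %| n)%N -> (q %| v)%N) -> coprime_shift_defect n v = 0%N.
Proof.
move=> n_gt0 rad_v; apply: eq_card0 => k; rewrite !inE; apply/negP => /andP[co_kn].
case/negP; apply/coprime_primeP => // q q_pr q_n.
by rewrite dvdn_addl ?rad_v //; apply: (coprime_primeP _ _ n_gt0 co_kn).
Qed.

(** The shift is divisible by every prime of [n] except [p], so it makes [k] a nonunit exactly when
    [p] divides the shifted index. The units modulo [n] are spread evenly over the [p.-1] nonzero
    classes modulo [p]. *)
Lemma coprime_shift_defect_pfactor n p : (0 < n)%N -> p \in primes n ->
  (coprime_shift_defect n (n %/ p ^ logn p n) * p.-1)%N = totient n.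
Proof.
move=> n_gt0; rewrite mem_primes => /and3P[p_pr _ p_n].
have p_gt0 := prime_gt0 p_pr.
pose D x := #|[pred k : 'I_n | coprime k n && (p %| k + x)%N]|.
(* [p.-1 * k] stands for $-k$ modulo [p]. *)
have dvd_pk k x : (p %| k + x)%N = (x == p.-1 * k %[mod p])%N.
  rewrite -(eqn_modDr k) -mulSnr prednK // modnMr addnC.
  by rewrite eq_sym.
have defectE v : coprime v p -> (forall q, prime q -> (q %| n)%N -> q != p -> (q %| v)%N) ->
    coprime_shift_defect n v = D v.
  move=> co_vp rad_v; apply: eq_card => k; rewrite !inE.
  have [co_kn /=|//] := boolP (coprime k n).
  apply/idP/idP => [|p_kv]; last first.
    by apply/negP => /(coprime_primeP _ _ n_gt0)/(_ p p_pr p_n); rewrite p_kv.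
  apply: contraR => p_kv; apply/coprime_primeP => // q q_pr q_n.
  have [-> //|q_p] := eqVneq q p.
  by rewrite dvdn_addl ?rad_v //; apply: (coprime_primeP _ _ n_gt0 co_kn).
have D1 x : coprime x p -> D x = D 1%N.
  (* Multiplication by a unit [u] congruent to [x] carries the class of $-1$ modulo [p] to that of
     $-x$. *)
  move=> co_xp; have [u co_un ux] := coprime_lift _ _ _ n_gt0 p_n co_xp.
  have co_pu : coprime p u by rewrite coprime_sym (coprime_dvdr p_n).
  rewrite -[LHS](card_mul_unit n u [pred k | coprime k n && (p %| k + x)%N]) //=.
    apply: eq_card => k; rewrite !inE coprimeMl co_un /=; congr (_ && _).
    rewrite -[RHS](Gauss_dvdr _ co_pu) mulnDr muln1 /dvdn -modnDmr -ux modnDmr //.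
  move=> k; rewrite coprime_modl; congr (_ && _).
  by rewrite /dvdn -modnDml modn_dvdm // modnDml.
have D0 : D 0%N = 0%N.
  apply: eq_card0 => k; rewrite !inE addn0; apply/negP => /andP[co_kn].
  by apply/negP; apply: (coprime_primeP _ _ n_gt0 co_kn).
have sumD : (\sum_(x < p) D x)%N = totient n.
  under eq_bigr => x _ do rewrite /D -sum1_card big_mkcond /=.
  rewrite exchange_big totient_count_coprime big_mkord; apply: eq_bigr => k _.
  rewrite -big_mkcond /= coprime_sym.
  have [co_kn /=|] := boolP (coprime k n); last first.
    by move=> /negPf co_kn; rewrite big_pred0 // => x; rewrite inE co_kn.
  rewrite (big_pred1 (Ordinal (ltn_pmod (p.-1 * k) p_gt0))) // => x.
  by rewrite inE co_kn /= dvd_pk -val_eqE /= [X in X == _]modn_small.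
set v := (n %/ p ^ logn p n)%N.
have nE : n = (p ^ logn p n * v)%N by rewrite mulnC divnK ?pfactor_dvdnn.
have co_vp : coprime v p.
  have [m co_pm nm] := pfactor_coprime p_pr n_gt0.
  by rewrite /v {1}nm mulnK ?expn_gt0 ?p_gt0 // coprime_sym.
rewrite defectE //; last first.
  move=> q q_pr; rewrite {1}nE Euclid_dvdM // => /orP[|//].
  by rewrite Euclid_dvdX // => /andP[]; rewrite dvdn_prime2 // => ->.
rewrite D1 // -sumD.
rewrite (bigD1 (Ordinal p_gt0)) //= D0 add0n.
rewrite (eq_bigr (fun=> D 1%N)) => [|x]; last first.
  rewrite -val_eqE -lt0n /= => x_gt0; apply: D1.
  by rewrite coprime_sym prime_coprime // gtnNdvd.
by rewrite sum_nat_const mulnC cardC1 card_ord.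
Qed.

(** * Distances between roots of unity *)

Lemma norm_prim_root n (z : algC) : n.-primitive_root z -> `|z| = 1.
Proof.
move=> z_prim; have n_gt0 := prim_order_gt0 z_prim.
by apply/eqP; rewrite -(pexpr_eq1 n_gt0) // -normrX (prim_expr_order z_prim) normr1.
Qed.

Lemma norm_prim_expr n (z : algC) i : n.-primitive_root z -> `|z ^+ i| = 1.
Proof. by move=> /norm_prim_root z1; rewrite normrX z1 expr1n. Qed.

(* The value [1] at [z ^+ v = 1] keeps full products over [v < n] nonzero. *)
Definition unity_dist (z : algC) v : algC :=
  if z ^+ v == 1 then 1 else `|1 - z ^+ v|.

(** Evaluation of $(X^n - 1)/(X - 1) = \prod_{0<v<n} (X - z^v)$ at $1$. *)
Lemma prod_unity_dist n z : n.-primitive_root z ->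
  \prod_(v < n) unity_dist z v = n%:R.
Proof.
move=> z_prim; case: n z_prim (prim_order_gt0 z_prim) => // n z_prim _.
have := factor_Xn_sub_1 z_prim; rewrite subrX1 big_nat_recl // expr0.
move/(mulfI (monic_neq0 (monicXsubC 1))) => /(congr1 (fun p => `|p.[1]|)).
rewrite horner_prod normr_prod horner_sum.
under [X in _ = `|X| -> _]eq_bigr => i _ do rewrite hornerXn expr1n.
rewrite sumr_const card_ord normr_nat => <-.
rewrite big_ord_recl {1}/unity_dist expr0 eqxx mul1r big_mkord.
apply: eq_bigr => i _; rewrite hornerXsubC /unity_dist -(prim_order_dvd z_prim).
by rewrite gtnNdvd // /bump ltnS ltn_ord.
Qed.

(** For [e > 1] this is $|\Phi_e(1)|$; for [e = 1] the convention in [unity_dist] gives 1. Both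
    sides multiply to [m] over the divisors of any [m] dividing [n], so Möbius inversion applies. *)
Lemma prod_unity_dist_coprime n z e : n.-primitive_root z -> (e %| n)%N ->
  \prod_(j < e | coprime j e) unity_dist z (n %/ e * j) = (mangoldt_exp e)%:R.
Proof.
move=> z_prim; have n_gt0 := prim_order_gt0 z_prim.
pose f e := \prod_(j < e | coprime j e) unity_dist z (n %/ e * j).
apply: (eq_from_divisors_prod _ n f (fun e => (mangoldt_exp e)%:R)) => // m m_n.
  rewrite pnatr_eq0 /mangoldt_exp -lt0n; case pm: (primes m) => [|p []] //.
  by have [/prime_gt0] := prime_powerP _ _ pm.
have m_gt0 := dvdn_gt0 n_gt0 m_n.
rewrite -natr_prod prod_mangoldt_exp //.
rewrite -(prod_unity_dist _ _ (dvdn_prim_root z_prim m_n)).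
rewrite (eq_bigr (fun k : 'I_m => unity_dist z (n %/ m * k)%N)); last first.
  by move=> k _; rewrite /unity_dist -exprM.
rewrite (big_ord_divisors _ _ _ _ (fun k => unity_dist z (n %/ m * k)%N)) //.
rewrite big_seq [RHS]big_seq; apply: eq_bigr => d; rewrite -dvdn_divisors // => d_m.
by apply: eq_bigr => k _; rewrite mulnA muln_divA // divnK.
Qed.

(** With $j = k + v$ the distance becomes $|1 - z^v|$, independent of [k]; exchanging the products
    leaves a count of the [k]. *)
Lemma prod_dist_unit_nonunit n z : n.-primitive_root z ->
  \prod_(k < n | coprime k n) \prod_(j < n | ~~ coprime j n) `|z ^+ k - z ^+ j| =
  \prod_(v < n) unity_dist z v ^+ coprime_shift_defect n v.
Proof.
move=> z_prim; have n_gt0 := prim_order_gt0 z_prim.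
transitivity (\prod_(k < n | coprime k n)
    \prod_(v < n | ~~ coprime (k + v) n) unity_dist z v).
  apply: eq_bigr => k co_kn.
  pose h (v : 'I_n) := Ordinal (ltn_pmod (k + v) n_gt0).
  have h_inj : injective h.
    move=> i j /(congr1 val) /= /eqP; rewrite eqn_modDl !modn_small // => /eqP.
    exact: val_inj.
  rewrite (reindex_inj h_inj); apply: eq_big => v /=; first by rewrite coprime_modl.
  rewrite coprime_modl (prim_expr_mod z_prim) exprD -{1}[z ^+ k]mulr1 -mulrBr normrM.
  rewrite (norm_prim_expr _ _ _ z_prim) mul1r /unity_dist; case: eqP => // /eqP.
  (* If $z^v = 1$ the shifted index is still a unit, so the conventional value never enters. *)
  rewrite -(prim_order_dvd z_prim) => n_v.
  by rewrite -coprime_modl -modnDmr (eqP n_v) addn0 coprime_modl co_kn.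
rewrite (exchange_big_dep xpredT) //; apply: eq_bigr => v _.
by rewrite prodr_const.
Qed.

(** The shifts of order [e] contribute a power of [mangoldt_exp e], so only prime powers [e] count.
    If [e] is not the full power of its prime in [n], every prime of [n] divides [n %/ e] and the
    defect is 0. *)
Lemma prod_dist_unit_nonunit_primes n (z : algC) : n.-primitive_root z ->
  \prod_(k < n | coprime k n) \prod_(j < n | ~~ coprime j n) `|z ^+ k - z ^+ j| =
  (\prod_(p <- primes n) p ^ (totient n %/ p.-1))%:R.
Proof.
move=> z_prim; have n_gt0 := prim_order_gt0 z_prim.
rewrite prod_dist_unit_nonunit //.
rewrite (big_ord_divisors _ _ _ _ (fun v => unity_dist z v ^+ coprime_shift_defect n v)) //.
transitivity (\prod_(e <- divisors n) (mangoldt_exp e)%:R ^+ coprime_shift_defect n (n %/ e) : algC).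
  rewrite big_seq [RHS]big_seq; apply: eq_bigr => e; rewrite -dvdn_divisors // => e_n.
  rewrite -(prod_unity_dist_coprime n z) // -prodrXl; apply: eq_bigr => j co_je.
  by rewrite coprime_shift_defect_divisor.
rewrite big_divisors_prime_powers //; last first.
  move=> d _; rewrite /mangoldt_exp; case: (primes d) => [|p []] // *; exact: expr1n.
rewrite natr_prod big_seq [RHS]big_seq; apply: eq_bigr => p p_n.
have [p_pr p_dvd_n] : prime p /\ (p %| n)%N by move: p_n; rewrite mem_primes => /and3P[].
have log_gt0 : (0 < logn p n)%N by rewrite logn_gt0.
have ltlog : ((logn p n).-1 < logn p n)%N by rewrite prednK.
rewrite (bigD1 (Ordinal ltlog)) //= big1 ?mulr1.
  rewrite prednK // /mangoldt_exp -(prednK log_gt0) primes_prime_power // prednK //.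
  rewrite -natrX -(coprime_shift_defect_pfactor n p) // mulnK //.
  by rewrite -subn1 subn_gt0 prime_gt1.
move=> i; rewrite -val_eqE /= => i_neq.
have lt_i : (i.+1 < logn p n)%N by have := ltn_ord i; lia.
rewrite coprime_shift_defect0 ?expr0 // => q q_pr q_n.
have [-> | q_p] := eqVneq q p.
  rewrite dvdn_divRL ?pfactor_dvdn // ?(ltnW lt_i) //.
  by rewrite -expnS pfactor_dvdn.
have pin : (p ^ i.+1 %| n)%N by rewrite pfactor_dvdn // ltnW.
move: q_n; rewrite -{1}(divnK pin) Euclid_dvdM // => /orP[//|].
by rewrite Euclid_dvdX // dvdn_prime2 // (negPf q_p).
Qed.

(** Rotation by $z^{-k}$ reduces the product to that of the distances from $1$. *)
Lemma prod_dist_neq n (z : algC) (k : 'I_n) : n.-primitive_root z ->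
  \prod_(j < n | j != k) `|z ^+ k - z ^+ j| = n%:R.
Proof.
move=> z_prim; have n_gt0 := prim_order_gt0 z_prim.
rewrite -(prod_unity_dist _ _ z_prim) [RHS](bigD1 (Ordinal n_gt0)) //=.
rewrite [X in _ = X * _]/unity_dist expr0 eqxx mul1r.
pose h (v : 'I_n) := Ordinal (ltn_pmod (k + v) n_gt0).
have h_inj : injective h.
  move=> i j /(congr1 val) /= /eqP; rewrite eqn_modDl !modn_small // => /eqP.
  exact: val_inj.
have h0 v : (h v == k) = (v == Ordinal n_gt0).
  have hk : h (Ordinal n_gt0) = k by apply: val_inj; rewrite /= addn0 modn_small.
  by rewrite -[RHS](inj_eq h_inj) hk.
rewrite (reindex_inj h_inj); apply: eq_big => v /=; first by rewrite h0.
rewrite h0 -val_eqE /= => v_neq0.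
rewrite (prim_expr_mod z_prim) exprD -{1}[z ^+ k]mulr1 -mulrBr normrM.
rewrite (norm_prim_expr _ _ _ z_prim) mul1r /unity_dist -(prim_order_dvd z_prim).
by rewrite gtnNdvd // lt0n.
Qed.

Lemma card_coprime_ord n : #|[pred k : 'I_n | coprime k n]| = totient n.
Proof.
rewrite totient_count_coprime big_mkord -sum1_card big_mkcond.
by apply: eq_bigr => k _; rewrite inE coprime_sym.
Qed.

Lemma prod_dist_units n (z : algC) : n.-primitive_root z ->
  \prod_(k < n | coprime k n) \prod_(j < n | coprime j n && (j != k)) `|z ^+ k - z ^+ j| =
  n%:R ^+ totient n / (\prod_(p <- primes n) p ^ (totient n %/ p.-1))%:R.
Proof.
move=> z_prim; rewrite -(prod_dist_unit_nonunit_primes _ _ z_prim).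
have T_neq0 : \prod_(k < n | coprime k n)
    \prod_(j < n | ~~ coprime j n) `|z ^+ k - z ^+ j| != 0.
  rewrite prod_dist_unit_nonunit //; apply/prodf_neq0 => v _; rewrite expf_neq0 //.
  by rewrite /unity_dist; case: ifP; rewrite ?oner_eq0 // normr_eq0 subr_eq0 eq_sym => ->.
apply: (mulIf T_neq0); rewrite divfK // -big_split /=.
rewrite -card_coprime_ord -prodr_const; apply: eq_bigr => k co_kn.
rewrite -(prod_dist_neq _ _ k z_prim) [RHS](bigID (fun j : 'I_n => coprime j n)) /=.
congr (_ * _); apply: eq_bigl => j; first by rewrite andbC.
by have [-> | _] := eqVneq j k; rewrite ?co_kn.
Qed.

Lemma prod_dist_1 n (z : algC) : (1 < n)%N -> n.-primitive_root z ->
  \prod_(k < n | coprime k n) `|1 - z ^+ k| = (mangoldt_exp n)%:R.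
Proof.
move=> n_gt1 z_prim; rewrite -(prod_unity_dist_coprime n z n) //.
apply: eq_bigr => k co_kn; rewrite divnn (ltnW n_gt1) mul1n /unity_dist.
rewrite -(prim_order_dvd z_prim) gtnNdvd // lt0n.
by apply/eqP => k0; move: co_kn; rewrite k0 /coprime gcd0n => /eqP n1; rewrite n1 in n_gt1.
Qed.

(** * Distances between the roots of the fibotomic polynomial *)

Lemma prod_coprime_rev (n : nat) (F : nat -> algC) : (1 < n)%N ->
  \prod_(j < n | coprime j n) F j = \prod_(j < n | coprime j n) F (n - j)%N.
Proof.
move=> n_gt1.
(* As [n > 1], the index 0 is not prime to [n]; on the remaining range the reflection is a
   bijection. *)
have E (G : nat -> algC) : \prod_(j < n | coprime j n) G j = \prod_(1 <= j < n | coprime j n) G j :> algC.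
  rewrite -(big_mkord (fun j => coprime j n)) big_mkcond big_ltn ?(ltnW n_gt1) //.
  by rewrite [coprime 0 n]/coprime gcd0n (gtn_eqF n_gt1) /= mul1r -big_mkcond.
rewrite E (E (fun j => F (n - j)%N)) big_nat_rev /= big_nat_cond [RHS]big_nat_cond.
apply: eq_big => [j|j _]; last by rewrite add1n subSS.
rewrite add1n subSS; case: (boolP (1 <= j < n)%N) => // /andP[_ /ltnW le_jn] /=.
rewrite /coprime.
have E1 : gcdn (n - j) n = gcdn (n - j) j by rewrite -{2}(subnK le_jn) gcdnDl.
have E2 : gcdn j n = gcdn j (n - j) by rewrite -{1}(subnK le_jn) gcdnDr.
by rewrite E1 E2 gcdnC.
Qed.

Lemma prod_fibroot_dist_at n w (k : 'I_n) : (1 < n)%N -> (2 * n).-primitive_root w ->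
  coprime k n ->
  `|1 - (w ^+ 2) ^+ k| *
    \prod_(j < n | coprime j n && (j != k)) `|fibroot w k - fibroot w j| =
  2 * \prod_(j < n | coprime j n && (j != k)) `|(w ^+ 2) ^+ k - (w ^+ 2) ^+ j|.
Proof.
move=> n_gt1 w_prim co_kn.
have w_neq0 : w != 0 by apply: prim_root_neq0 w_prim.
have w1 i : `|w ^+ i| = 1 by apply: norm_prim_expr w_prim.
have wn : w ^+ n = -1.
  have /eqP := prim_expr_order w_prim; rewrite mulnC exprM sqrf_eq1 => /orP[|/eqP //].
  by rewrite -(prim_order_dvd w_prim) => /dvdn_leq; lia.
have distE j : `|fibroot w k - fibroot w j| = `|1 - w ^+ (k + j)| * `|w ^+ k - w ^+ j|.
  rewrite fibrootB // !normrM !normfV !w1 normCi !invr1 !mul1r.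
  by rewrite [X in X * _]distrC.
have sqE j : `|(w ^+ 2) ^+ k - (w ^+ 2) ^+ j| = `|w ^+ k + w ^+ j| * `|w ^+ k - w ^+ j|.
  by rewrite -normrM mulrC -subr_sqr -!exprM ![(2 * _)%N]mulnC.
under eq_bigr => j _ do rewrite distE.
under [in RHS]eq_bigr => j _ do rewrite sqE.
rewrite !big_split /= !mulrA; congr (_ * _).
(* The prefactors are the terms missing at [j = k]: $|1 - w^{2k}|$ here, $|w^k + w^k| = 2$ below. *)
have -> : `|1 - (w ^+ 2) ^+ k| * \prod_(j < n | coprime j n && (j != k)) `|1 - w ^+ (k + j)|
    = \prod_(j < n | coprime j n) `|1 - w ^+ (k + j)|.
  by rewrite [RHS](bigD1 k) //= -exprM addnn -muln2 mulnC.
have -> : 2 * \prod_(j < n | coprime j n && (j != k)) `|w ^+ k + w ^+ j|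
    = \prod_(j < n | coprime j n) `|w ^+ k + w ^+ j|.
  by rewrite [RHS](bigD1 k) //= -mulr2n normrMn w1.
rewrite (prod_coprime_rev _ (fun j => `|1 - w ^+ (k + j)|)) //.
apply: eq_bigr => j _.
(* Multiplying by $|w^j| = 1$ turns $w^{k+n-j}$ into $w^{k+n} = -w^k$. *)
rewrite -[LHS]mul1r -[X in X * _](w1 j) -normrM mulrBr mulr1 -exprD addnCA subnKC ?(ltnW (ltn_ord j)) //.
by rewrite exprD wn mulrN1 opprK addrC.
Qed.

Lemma prod_fibroot_dist n w : (1 < n)%N -> (2 * n).-primitive_root w ->
  \prod_(k < n | coprime k n) \prod_(j < n | coprime j n && (j != k))
    `|fibroot w k - fibroot w j| =
  (2 * n)%:R ^+ totient n /
    (mangoldt_exp n * \prod_(p <- primes n) p ^ (totient n %/ p.-1))%:R.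
Proof.
move=> n_gt1 w_prim.
have z_prim : n.-primitive_root (w ^+ 2).
  have := dvdn_prim_root w_prim (dvdn_mull 2 (dvdnn n)).
  by rewrite mulnK // (ltnW n_gt1).
rewrite [(2 * n)%:R]natrM exprMn [(mangoldt_exp n * _)%:R]natrM invfM mulrCA -(mulrA (2 ^+ _)) -(prod_dist_units _ _ z_prim).
rewrite -(prod_dist_1 _ _ n_gt1 z_prim).
apply: (canRL (mulKf _)).
  apply/prodf_neq0 => k co_kn; rewrite normr_eq0 subr_eq0 eq_sym.
  rewrite -(prim_order_dvd z_prim) gtnNdvd // lt0n.
  by apply/eqP => k0; move: co_kn; rewrite k0 /coprime gcd0n => /eqP n1; rewrite n1 in n_gt1.
rewrite -big_split -card_coprime_ord -prodr_const -big_split /=.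
apply: eq_bigr => k co_kn; exact: prod_fibroot_dist_at.
Qed.

(** * Sign and value of the discriminant *)

Lemma prod_neq_ltn (R : comNzRingType) m (A : 'I_m -> 'I_m -> R) :
  (forall i j, A i j = A j i) ->
  \prod_(i < m) \prod_(j < m | j != i) A i j =
  \prod_(i < m) \prod_(j < m | (i < j)%N) A i j ^+ 2.
Proof.
move=> Asym.
transitivity ((\prod_(i < m) \prod_(j < m | (i < j)%N) A i j) *
    \prod_(i < m) \prod_(j < m | (j < i)%N) A i j).
  rewrite -big_split; apply: eq_bigr => i _ /=.
  rewrite (bigID (fun j : 'I_m => (i < j)%N)) /=.
  congr (_ * _); apply: eq_bigl => j; rewrite -val_eqE /=; case: ltngtP => //.
rewrite [X in _ * X](exchange_big_dep xpredT) //= -big_split; apply: eq_bigr => i _ /=.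
by rewrite -big_split; apply: eq_bigr => j _ /=; rewrite [A j i]Asym expr2.
Qed.

Lemma prod_neq_seq (T : eqType) (R : comNzRingType) (x0 : T) (e : seq T)
    (A : T -> T -> R) : uniq e ->
  \prod_(x <- e) \prod_(y <- e | y != x) A x y =
  \prod_(i < size e) \prod_(j < size e | j != i) A (nth x0 e i) (nth x0 e j).
Proof.
move=> e_uniq; rewrite (big_nth x0) big_mkord; apply: eq_bigr => i _.
rewrite (big_nth x0) big_mkord; apply: eq_bigl => j.
by rewrite nth_uniq.
Qed.

(** On the unit circle $w^k + w^{-k}$ is real, so the difference is purely imaginary. *)
Lemma fibrootB_sqr (w : algC) j k : `|w| = 1 ->
  (fibroot w j - fibroot w k) ^+ 2 = - `|fibroot w j - fibroot w k| ^+ 2.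
Proof.
move=> w1.
have real i : w ^+ i + w ^- i \is Num.real.
  rewrite CrealE rmorphD /= fmorphV !rmorphXn /= addrC.
  have -> : w^* = w^-1.
    apply: (mulfI (_ : w != 0)); first by rewrite -normr_eq0 w1 oner_eq0.
    by rewrite -normCK w1 expr1n mulfV // -normr_eq0 w1 oner_eq0.
  by rewrite !exprVn invrK.
rewrite /fibroot -mulrBr exprMn sqrCi normrM normCi mul1r mulN1r real_normK //.
by rewrite rpredB.
Qed.

Lemma signr_bin2 (R : comNzRingType) m : (-1) ^+ 'C(m, 2) = (-1) ^+ m./2 :> R.
Proof.
rewrite bin2 -[m in LHS]odd_double_half; set h := m./2.
rewrite -signr_odd -[RHS]signr_odd; congr (_ ^+ nat_of_bool _).
case: (odd m) => /=.
  by rewrite add1n /= -doubleMr doubleK oddM /= odd_double.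
case: h => [|h] //; rewrite add0n -doubleMl doubleK oddM.
by rewrite doubleS /= odd_double andbT.
Qed.

Lemma disc_fibroots n w : (1 < n)%N -> (2 * n).-primitive_root w ->
  disc [seq fibroot w k | k : 'I_n <- enum [pred k : 'I_n | coprime k n]] =
  (-1) ^+ (totient n)./2 * (2 * n)%:R ^+ totient n /
    (mangoldt_exp n * \prod_(p <- primes n) p ^ (totient n %/ p.-1))%:R.
Proof.
move=> n_gt1 w_prim; rewrite -mulrA -(prod_fibroot_dist _ _ n_gt1 w_prim).
set P := [pred k : 'I_n | coprime k n]; set e := enum P.
have sz_e : size e = totient n by rewrite -card_coprime_ord cardE.
have w1 := norm_prim_root _ _ w_prim.
pose x0 : 'I_n := Ordinal (ltnW n_gt1).
have nth_s (i : 'I_(size e)) : [seq fibroot w k | k : 'I_n <- e]`_i = fibroot w (nth x0 e i).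
  by rewrite (nth_map x0).
rewrite /disc size_map.
under eq_bigr => i _ do under eq_bigr => j _ do
  rewrite !nth_s fibrootB_sqr // -mulN1r.
under eq_bigr => i _ do rewrite big_split /=.
(* Each pair [i < j] yields one sign; the remaining squares form the product over ordered pairs of
   distinct roots. *)
rewrite big_split /= prod_ltn_const signr_bin2; congr (_ * _); first by rewrite sz_e.
rewrite -prod_neq_ltn => [|i j]; last exact: distrC.
rewrite -(prod_neq_seq _ _ x0 e (fun j k => `|fibroot w j - fibroot w k|)) ?enum_uniq //.
rewrite big_enum /=; apply: eq_bigr => k _.
by rewrite big_enum_cond.
Qed.

Lemma fibotomic_discriminant (Psi : nat -> {poly int}) n (D : rat) :
  (forall m, (0 < m)%N -> fibpoly m = \prod_(d <- divisors m) Psi d) -> (1 < n)%N ->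
  D = (-1) ^+ (totient n)./2 * (2 * n)%:R ^+ totient n /
    (mangoldt_exp n * \prod_(p <- primes n) p ^ (totient n %/ p.-1))%:R ->
  is_discriminant (homog (map_poly intr (Psi n)) (totient n))
    (D%:P * 'X^(totient n * (totient n).-1)).
Proof.
move=> PsiE n_gt1 DE; have n_gt0 := ltnW n_gt1.
have n2_gt0 : (0 < 2 * n)%N by rewrite muln_gt0.
have [w w_prim] := C_prim_root_exists n2_gt0.
pose e := enum [pred k : 'I_n | coprime k n].
pose s := [seq fibroot w k | k : 'I_n <- e].
have sz_s : size s = totient n by rewrite size_map -card_coprime_ord cardE.
pose g : {poly rat} -> {poly algC} := map_poly ratr.
apply: (is_discriminant_inj _ _ g _ _ [seq r%:P * 'X | r <- s]).
- exact: map_poly_inj.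
- rewrite homog_map -map_poly_comp (eq_map_poly (g := intr)); last first.
    by move=> i /=; rewrite ratr_int.
  rewrite (fibotomic_roots _ _ _ PsiE w_prim) -sz_s big_map -homog_prod_XsubC.
  congr (homog _ _); rewrite big_map big_enum /=; apply: eq_bigr => k co_kn.
  (* The default factor 1 at [k = 0] does not occur, since [n > 1]. *)
  rewrite /fibfactor; case: eqP => // k0; move: co_kn.
  by rewrite k0 /coprime gcd0n => /eqP n1; rewrite n1 in n_gt1.
rewrite disc_scale sz_s /g rmorphM /= map_polyC map_polyXn /= disc_fibroots //.
rewrite DE; congr (_%:P * _).
by rewrite fmorph_div rmorphM /= rmorph_sign rmorphXn /= !rmorph_nat.
Qed.

Theorem theorem1 (Psi : nat -> {poly int})
  (HPsi1 : Psi 1%N = 1)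
  (HPsi : forall m : nat, (0 < m)%N ->
            fibpoly m = \prod_(d <- divisors m) Psi d)
  (n : nat) (hn : (2 <= n)%N) :
  let phi := totient n in
  let PsiXY : {poly {poly rat}} := homog (map_poly intr (Psi n)) phi in
  (forall (p a : nat), prime p -> (0 < a)%N -> n = (p ^ a)%N ->
     is_discriminant PsiXY
       (((-1) ^+ phi./2 * ((2 * n)%:R) ^+ phi
           / ((p ^ (p ^ a.-1 + 1))%N)%:R)%:P * 'X^(phi * phi.-1)))
  /\
  (~ (exists p a : nat, [/\ prime p, (0 < a)%N & n = (p ^ a)%N]) ->
     is_discriminant PsiXY
       (((-1) ^+ phi./2 * ((2 * n)%:R) ^+ phi
           / (\prod_(p <- primes n) (p ^ (phi %/ p.-1)))%:R)%:P
          * 'X^(phi * phi.-1))).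
Proof.
move=> phi PsiXY; split=> [p a p_pr a_gt0 nE | not_pp].
  apply: fibotomic_discriminant => //; congr (_ / _%:R).
  have pn : primes n = [:: p] by rewrite nE -(prednK a_gt0) primes_prime_power.
  (* [mangoldt_exp n] supplies one factor [p], and $\varphi(n)/(p-1) = p^{a-1}$. *)
  rewrite /mangoldt_exp pn big_seq1 nE totient_pfactor // mulKn.
    by rewrite -expnS addn1.
  by rewrite -subn1 subn_gt0 prime_gt1.
apply: fibotomic_discriminant => //; congr (_ / _%:R).
(* [mangoldt_exp n] is 1 unless [n] has a single prime divisor, which would make it a prime
   power. *)
rewrite /mangoldt_exp; case pn: (primes n) => [|p [|q s]]; rewrite ?mul1n //.
have [p_pr [i nE]] := prime_powerP _ _ pn.
by case: not_pp; exists p, i.+1.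
Qed.
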